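(* Let $D$ be an open interval $(a,b)$ or the circle, and let $f_1,\dots,f_n: D\to\mathbb{R}$ be a Chebyshev system of order $n$ on $D$. Put $m(D,n)=n$ if $D$ is an interval and $m(D,n)=n+1$ if $D$ is the circle. Let $f: D\to\mathbb{R}$ be a continuous function whose number of sign changes on $D$ is no less than $m(D,n)$. Then there exists a continuous function $\rho : D\to\mathbb{R}$ of constant sign such that $f$ is orthogonal on $D$ to the given Chebyshev system with the weight function $\rho$, i.e. $\int_D f(x)f_i(x)\rho(x)\,dx=0$ for all $i=1,\dots,n$.
   Context: The circle is parametrized by $[0,2\pi]$ with endpoints identified (functions on it are $2\pi$-periodic), and $dx$ is the corresponding measure. A set of continuous functions $f_1,\dots,f_n : D\to\mathbb{R}$ is a Chebyshev system (of order $n$) on $D$ if for any real constants $c_1,\dots,c_n$, not all zero, the function $\sum_{j=1}^n c_jf_j(x)$ vanishes at no more than $n-1$ different points of $D$. (On the circle the order $n$ is necessarily odd.) A function is of constant sign if it is nonnegative everywhere or nonpositive everywhere, and not identically zero. Sign changes: for a continuous function $f$ on $D$, each connected component of the zero set of $f$ is a point or an interval. The function $f$ changes sign on such a component if in any neighborhood of this component there exist two points at which the values of $f$ have opposite (nonzero) signs. The number of sign changes (zeros) of $f$ is the number of connected components of the zero set on which $f$ changes sign. *)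

(* Defs.v *)
From HB Require Import structures.
From mathcomp Require Import all_boot all_order all_algebra.
From mathcomp Require Import generic_quotient.
From mathcomp Require Import all_classical all_reals all_analysis.

Set Implicit Arguments.
Unset Strict Implicit.
Unset Printing Implicit Defensive.

Import Order.TTheory GRing.Theory Num.Theory.
Import numFieldNormedType.Exports.

Local Open Scope classical_set_scope.
Local Open Scope card_scope.
Local Open Scope ring_scope.

Section Circle.
Local Open Scope quotient_scope.
Variable R : realType.

Definition circle_eq (x y : R) : bool :=
  `[< exists k : int, x - y = k%:~R * (2 * pi) >].

Lemma circle_eq_refl : reflexive circle_eq.
Proof. by move=> x; apply/asboolP; exists 0; rewrite subrr mul0r. Qed.

Lemma circle_eq_sym : symmetric circle_eq.
Proof.
suff H x y : circle_eq x y -> circle_eq y x by move=> x y; apply/idP/idP; exact: H.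
move=> /asboolP[k xy]; apply/asboolP; exists (- k).
by rewrite -opprB xy mulrNz mulNr.
Qed.

Lemma circle_eq_trans : transitive circle_eq.
Proof.
move=> y x z /asboolP[k xy] /asboolP[l yz]; apply/asboolP; exists (k + l).
by rewrite mulrzDr mulrDl -xy -yz subrKA.
Qed.

Definition circle_rel := EquivRel _ circle_eq_refl circle_eq_sym circle_eq_trans.

(* R / 2 pi Z with the quotient topology, so that continuous functions on
   [circle] are exactly continuous 2pi-periodic functions on R. *)
Definition circle := {eq_quot circle_rel}.

HB.instance Definition _ := Topological.copy circle (quotient_topology circle).
HB.instance Definition _ := Quotient.on circle.

Definition circle_pi (x : R) : circle := \pi_circle x.

End Circle.

(* The endpoints of an interval are allowed to be infinite. *)
Inductive domain (R : realType) : Type :=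
| OpenInterval (a b : \bar R) of (a < b)%E
| Circle.

Arguments Circle {R}.

Definition ambient (R : realType) (D : domain R) : topologicalType :=
  match D with
  | OpenInterval _ _ _ => R
  | Circle => circle R
  end.

Definition points (R : realType) (D : domain R) : set (ambient D) :=
  match D with
  | OpenInterval a b _ => [set x : R | (a < x%:E)%E /\ (x%:E < b)%E]
  | Circle => [set: circle R]
  end.

Arguments points {R} D _.

(* The measure dx on D is Lebesgue measure on [params D], transported along
   [param D]. *)
Definition params (R : realType) (D : domain R) : set R :=
  match D with
  | OpenInterval a b _ => [set x | (a < x%:E)%E /\ (x%:E < b)%E]
  | Circle => `[0, 2 * pi]
  end.

Arguments params {R} D _.

Definition param (R : realType) (D : domain R) : R -> ambient D :=
  match D with
  | OpenInterval _ _ _ => id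
  | Circle => @circle_pi R
  end.

Arguments param {R} D _.

Definition required_sign_changes (R : realType) (D : domain R) (n : nat) : nat :=
  match D with
  | OpenInterval _ _ _ => n
  | Circle => n.+1
  end.

Section Functions.
Variables (R : realType) (T : topologicalType) (D : set T).

Definition zero_set (f : T -> R) : set T := [set x | D x /\ f x = 0].

Definition chebyshev_system (n : nat) (f : 'I_n -> T -> R) : Prop :=
  (forall j, {within D, continuous (f j)}) /\
  (forall c : 'I_n -> R, (exists j, c j <> 0) ->
     zero_set (fun x => \sum_(j < n) c j * f j x) #<= `I_n.-1).

Definition constant_sign (f : T -> R) : Prop :=
  ((forall x, D x -> 0 <= f x) \/ (forall x, D x -> f x <= 0)) /\
  (exists2 x, D x & f x <> 0).

Definition zero_components (f : T -> R) : set (set T) :=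
  [set connected_component (zero_set f) x | x in zero_set f].

Definition changes_sign_on (f : T -> R) (C : set T) : Prop :=
  forall U, set_nbhs C U ->
    exists x y, [/\ D x /\ U x, D y /\ U y, f x < 0 & 0 < f y].

(* The number of sign changes is the cardinality, possibly infinite, of this
   set. *)
Definition sign_changes (f : T -> R) : set (set T) :=
  [set C | zero_components f C /\ changes_sign_on f C].

End Functions.

(* Integrability is part of the definition, since the Lebesgue integral of a
   non-integrable function is also given a value by the library. *)
Definition orthogonal_with_weight (R : realType) (D : domain R)
    (rho f g : ambient D -> R) : Prop :=
  let h := fun t => (f (param D t) * g (param D t) * rho (param D t))%:E in
  (@lebesgue_measure R).-integrable (params D) h /\
  (\int[@lebesgue_measure R]_(t in params D) h t = 0)%E.

(* Main.v *)
(* Choose points x_0 < ... < x_n at which f alternates in sign, and move them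
   rigidly to x_l + u with |u| <= d.  For each u the n equations
   sum_l w_l f(x_l + u) f_i(x_l + u) = 0 in n + 1 unknowns are solved by the
   signed maximal minors of the matrix f(x_l + u) f_i(x_l + u), which are
   continuous in u.  Two adjacent minors have the same sign: a combination F of
   the f_i vanishing at the other n - 1 points reduces the relation to two terms,
   in which f changes sign, whereas F does not, having no room for another zero.
   Spreading the positive solutions w_l(u), times a bump psi(u), over the
   intervals around the points x_l gives the weight: substituting t = x_l + u in
   the integral of f f_i rho leaves an integrand that vanishes for every u.

   On the circle, at most one of the n + 1 zero components meets the cut point 0,
   and the n others are sign changes on the open interval (0, 2 pi), where the
   weight found above has compact support. *)
Require Import Defs.
From mathcomp Require Import all_boot all_order all_algebra.
From mathcomp Require Import all_classical all_reals all_analysis.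
From mathcomp Require Import ring lra zify.
Import Order.TTheory GRing.Theory Num.Theory.
Import numFieldNormedType.Exports.
Set Implicit Arguments.
Unset Strict Implicit.
Unset Printing Implicit Defensive.
Local Open Scope classical_set_scope.
Local Open Scope card_scope.
Local Open Scope ring_scope.

(** * Signed minors of a Chebyshev system *)

(** The kernel vector that Cramer's rule attaches to [n] equations in [n.+1] unknowns: the cofactors
    along a row added on top of [M]. *)
Definition signed_minor (R : comPzRingType) n (M : 'M[R]_(n, n.+1)) (j : 'I_n.+1) : R :=
  (-1) ^+ j * \det (col' j M).

(** Put a second copy of row [i] on top of [M]: expanding along it gives the determinant of a matrix
    with two equal rows. *)
Lemma sum_signed_minor (R : comPzRingType) n (M : 'M[R]_(n, n.+1)) (i : 'I_n) :
  \sum_j M i j * signed_minor M j = 0.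
Proof.
pose B : 'M[R]_n.+1 := \matrix_(k, j) M (odflt i (unlift 0 k)) j.
have B0 j : B 0 j = M i j by rewrite mxE unlift_none.
have Bi j l : B (lift 0 l) j = M l j by rewrite mxE liftK.
transitivity (\det B); last first.
  by apply: (@determinant_alternate _ _ _ 0 (lift 0 i)) => // j; rewrite B0 Bi.
rewrite (expand_det_row B 0); apply: eq_bigr => j _; rewrite B0; congr (_ * _).
rewrite /signed_minor /cofactor add0n; congr (_ * \det _).
by apply/matrixP => k l; rewrite !mxE liftK.
Qed.

Section ChebyshevMinors.
Variables (R : realType) (n : nat) (D : set R) (fs : 'I_n -> R -> R).
Hypothesis D_interval : is_interval D.
Hypothesis fs_chebyshev : chebyshev_system D fs.

Lemma chebyshev_zeros (v : 'rV[R]_n) (z : 'I_n -> R) :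
    injective z -> (forall m, D (z m)) ->
    (forall m, \sum_i v 0 i * fs i (z m) = 0) ->
  v = 0.
Proof.
move=> z_inj zD z0; apply/eqP/negPn/negP => v0.
have /existsP [j vj] : [exists j, v 0 j != 0].
  apply: contraNT v0; rewrite negb_exists => /forallP v0.
  by apply/eqP/rowP => j; rewrite mxE; apply/eqP; move: (v0 j); rewrite negbK.
(* A nonzero coefficient excludes [n = 0], where the bound [n.-1] would not be below [n]. *)
have n_gt0 : (0 < n)%N := leq_ltn_trans (leq0n j) (ltn_ord j).
have [_ /(_ (v 0)) fs_zeros] := fs_chebyshev.
have {}fs_zeros := fs_zeros (ex_intro _ j (elimN eqP vj)).
have : `I_n #<= `I_n.-1.
  (* [h] extends [z] to all naturals, with the default value [z j] from [n] on, as cardinalities are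
     compared through sets of naturals. *)
  apply: card_le_trans fs_zeros; pose h k := odflt (z j) (omap z (insub k)).
  have hE (k : nat) (kn : (k < n)%N) : h k = z (Ordinal kn).
    by rewrite /h insubT.
  have h_inj : {in `I_n &, injective h}.
    move=> k l; rewrite !inE /= => kn ln.
    by rewrite (hE _ kn) (hE _ ln) => /z_inj [].
  rewrite -(card_le_eql (inj_card_eq h_inj)); apply: subset_card_le.
  by move=> _ [k /= kn <-]; rewrite hE; split=> //; exact: zD.
by rewrite card_le_II -ltnS prednK// ltnn.
Qed.

Section Alternating.
Variables (y : 'I_n.+1 -> R) (g : R -> R).
Hypothesis y_homo : {homo y : k l / (k < l)%O >-> k < l}.
Hypothesis yD : forall l, D (y l).
Hypothesis g_alt : forall k : 'I_n, g (y (widen_ord (leqnSn n) k)) * g (y (lift ord0 k)) < 0.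

Let M : 'M[R]_(n, n.+1) := \matrix_(i, l) (g (y l) * fs i (y l)).

(** Every index belongs to an adjacent pair once [n] is positive, which [k] witnesses; for [n = 0]
    there is no pair. *)
Lemma alternating_neq0 (k : 'I_n) l : g (y l) != 0.
Proof.
apply/eqP => gl0; case: (unliftP ord0 l) => [m lE|l0].
  by have := g_alt m; rewrite -lE gl0 mulr0 ltxx.
have n_gt0 : (0 < n)%N := leq_ltn_trans (leq0n k) (ltn_ord k).
have := g_alt (Ordinal n_gt0); rewrite (_ : widen_ord _ _ = l).
  by rewrite gl0 mul0r ltxx.
by apply: val_inj; rewrite l0.
Qed.

Lemma increasing_inj : injective y.
Proof.
move=> k l; case: (ltgtP k l) => // kl ykl; [have := y_homo kl|have := y_homo kl];
  by rewrite ykl ltxx.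
Qed.

(** A vanishing minor has a left kernel vector; after division by the nonzero values of [g], a
    nontrivial combination of the [fs] vanishes at the [n] points other than [y j]. *)
Lemma signed_minor_neq0 j : signed_minor M j != 0.
Proof.
rewrite /signed_minor mulf_eq0 signr_eq0 /=; apply/negP => /det0P [v v0 vM].
move/negP: v0; apply; apply/eqP.
apply: (@chebyshev_zeros v (y \o lift j)) => [k l /increasing_inj/lift_inj//|m /=|m /=].
  exact: yD.
apply: (mulfI (alternating_neq0 m (lift j m))).
rewrite mulr0 mulr_sumr -[RHS](_ : (v *m col' j M) 0 m = 0); last by rewrite vM mxE.
by rewrite mxE; apply: eq_bigr => i _; rewrite !mxE mulrCA.
Qed.

Lemma signed_minor_adjacent (k : 'I_n) :
  0 < signed_minor M (widen_ord (leqnSn n) k) * signed_minor M (lift ord0 k).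
Proof.
set k0 := widen_ord _ k; set k1 := lift ord0 k.
have k1E : lift k0 k = k1 by apply: val_inj; rewrite /= /bump leqnn.
(* Column [k], which belongs to [y k1], is zeroed to make [A] singular; a kernel vector then gives
   an [F] vanishing at the [n - 1] points other than [y k0] and [y k1]. *)
pose A : 'M[R]_n := \matrix_(i, m) if m == k then 0 else fs i (y (lift k0 m)).
have /eqP/det0P [v v0 vA] : \det A = 0.
  by rewrite (expand_det_col A k) big1// => i _; rewrite mxE eqxx mul0r.
pose F x := \sum_i v 0 i * fs i x.
have F0 (m : 'I_n) : m != k -> F (y (lift k0 m)) = 0.
  move=> /negPf mk; transitivity ((v *m A) 0 m); last by rewrite vA mxE.
  by rewrite mxE; apply: eq_bigr => i _; rewrite mxE mk.
have k01 : y k0 < y k1 by apply: y_homo; rewrite ltEord.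
(* A zero [w] in this segment would differ from those zeros and raise their number to [n]. *)
have Fneq0 w : y k0 <= w <= y k1 -> F w != 0.
  move=> /andP[k0w wk1]; apply/eqP => Fw; move/eqP: v0; apply.
  pose z (m : 'I_n) := if m == k then w else y (lift k0 m).
  have zD (m : 'I_n) : D (z m).
    rewrite /z; case: ifP => // _.
    by apply: (D_interval (yD k0) (yD k1)); rewrite k0w.
  have z_neq (m : 'I_n) : m != k -> z k != z m.
    move=> mk; rewrite /z eqxx (negPf mk); apply/eqP => wE.
    have : (m < k)%N || (k < m)%N by rewrite -neq_ltn.
    case/orP => [mltk|kltm].
      have : y (lift k0 m) < y k0.
        apply: y_homo; change (bump k m < k)%N.
        by rewrite /bump (leqNgt k m) mltk.
      by rewrite -wE ltNge k0w.
    have : y k1 < y (lift k0 m).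
      by apply: y_homo; change (bump 0 k < bump k m)%N; rewrite /bump (ltnW kltm).
    by rewrite -wE ltNge wk1.
  apply: (@chebyshev_zeros v z) => // [m l|m].
    have [->|mk] := eqVneq m k; have [->|lk] := eqVneq l k => //.
    - by move=> /eqP; rewrite (negPf (z_neq _ lk)).
    - by move=> /esym/eqP; rewrite (negPf (z_neq _ mk)).
    - by rewrite /z (negPf mk) (negPf lk) => /increasing_inj/lift_inj.
  by rewrite /z; case: ifPn => [_|/F0].
have F_cont : {within D, continuous F}.
  have [fs_cont _] := fs_chebyshev.
  apply: (continuous_big add_continuous) => i _ x.
  by apply: cvgM; [exact: cvg_cst|exact: fs_cont].
have FF : 0 < F (y k0) * F (y k1).
  rewrite ltNge; apply/negP => FF.
  have [||w] := @IVT _ F (y k0) (y k1) 0 (ltW k01).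
  - apply: continuous_subspaceW F_cont => w /=; rewrite in_itv/=; exact: D_interval.
  - rewrite ge_min le_max; case: (ltgtP (F (y k0)) 0) FF => [F0lt|F0gt|//] /=.
      by rewrite nmulr_rle0.
    by rewrite pmulr_rle0// => ->.
  by rewrite in_itv/= => /Fneq0/eqP.
(* The relations of [sum_signed_minor], weighted by [v]: every term with [F (y j) = 0] drops out. *)
have : g (y k0) * F (y k0) * signed_minor M k0 + g (y k1) * F (y k1) * signed_minor M k1 = 0.
  transitivity (\sum_i v 0 i * \sum_j M i j * signed_minor M j); last first.
    by rewrite big1// => i _; rewrite sum_signed_minor mulr0.
  transitivity (\sum_j g (y j) * F (y j) * signed_minor M j).
    rewrite (bigD1 k0)//= (bigD1 k1)/=; last by rewrite -k1E eq_sym neq_lift.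
    rewrite big1 ?addr0// => j /andP[jk0 jk1].
    case: (unliftP k0 j) => [m jE|/eqP]; last by rewrite (negPf jk0).
    rewrite jE F0 ?mulr0 ?mul0r//; apply: contraNneq jk1 => mk.
    by rewrite jE mk k1E.
  under [RHS]eq_bigr do rewrite mulr_sumr.
  rewrite exchange_big/=; apply: eq_bigr => j _.
  rewrite mulr_sumr mulr_suml; apply: eq_bigr => i _; rewrite mxE; ring.
move: (g_alt k) (Fneq0 (y k1)) (signed_minor_neq0 k1) (alternating_neq0 k k1) FF.
rewrite -/k0 -/k1 lexx (ltW k01).
move: (F (y k0)) (F (y k1)) (g (y k0)) (g (y k1)) (signed_minor M k0) (signed_minor M k1).
move=> F0' F1 g0 g1 d0 d1 gg /(_ isT) F10 d10 g10 FF dE.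
(* The two terms are opposite, so their product is minus a nonzero square; as [g] changes sign and
   [F] does not, [d0 * d1] is positive. *)
have E : d0 * d1 * (g0 * g1) * (F0' * F1) = - (g1 * F1 * d1) ^+ 2.
  transitivity ((g0 * F0' * d0) * (g1 * F1 * d1)); first by ring.
  have -> : g0 * F0' * d0 = - (g1 * F1 * d1) by apply/eqP; rewrite -addr_eq0 dE.
  by ring.
have : d0 * d1 * (g0 * g1) * (F0' * F1) < 0.
  by rewrite E oppr_lt0 exprn_even_gt0//= !mulf_neq0.
by rewrite pmulr_llt0// nmulr_llt0.
Qed.

(** Adjacent signs propagate by induction: the product of two positive products contains the square
    of the middle minor, which is cancelled. *)
Lemma signed_minor_same_sign j : 0 < signed_minor M ord0 * signed_minor M j.
Proof.
suff H k (kn : (k < n.+1)%N) : 0 < signed_minor M ord0 * signed_minor M (Ordinal kn).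
  by case: j => j jn; exact: H.
elim: k kn => [|k IH] kn.
  rewrite (_ : Ordinal kn = ord0); last exact: val_inj.
  by rewrite -expr2 exprn_even_gt0//= signed_minor_neq0.
have := mulr_gt0 (IH (ltnW kn)) (signed_minor_adjacent (Ordinal (kn : k < n)%N)).
rewrite (_ : widen_ord _ _ = Ordinal (ltnW kn)); last exact: val_inj.
rewrite (_ : lift _ _ = Ordinal kn); last exact: val_inj.
rewrite mulrA -(mulrA (signed_minor M ord0)) -expr2 mulrAC pmulr_lgt0//.
by rewrite exprn_even_gt0//= signed_minor_neq0.
Qed.

End Alternating.
End ChebyshevMinors.

(** * Integrals of translates *)

Section Translates.
Variable R : realType.
Local Notation mu := (@lebesgue_measure R).

(** The support of the translate lies in [A], so [A] may be exchanged for the segment around [x],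
    where [u = t - x] is substituted. The resulting domain does not depend on [x]. *)
Lemma integral_translate (H : R -> R) (x d : R) (A : set R) :
    0 < d -> measurable A -> continuous H ->
    (forall u, d < `|u| -> H u = 0) -> `[x - d, x + d] `<=` A ->
  mu.-integrable A (fun t => (H (t - x))%:E) /\
  (\int[mu]_(t in A) (H (t - x))%:E = \int[mu]_(u in `[(- d)%R, d]) (H u)%:E)%E.
Proof.
move=> d0 mA H_cont H0 sub.
have Hx0 t : ~ t \in `[x - d, x + d] -> H (t - x) = 0.
  by move=> tx; apply: H0; rewrite ltNge ler_distl; apply/negP; rewrite in_itv/= in tx.
have Hx_cont : continuous (fun t => H (t - x)).
  by move=> t; apply: continuous_comp; [apply: cvgB; [exact: cvg_id|exact: cvg_cst]|exact: H_cont].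
have restrictE B : `[x - d, x + d] `<=` B ->
    (fun t => (H (t - x))%:E) \_ B = (fun t => (H (t - x))%:E).
  move=> xB; apply/funext => t; rewrite patchE; case: ifPn => // /negP tB.
  by rewrite Hx0// => /xB tB'; apply: tB; rewrite inE.
split.
  apply: (@integrableS _ _ _ mu setT) => //.
  rewrite -(restrictE _ (@subset_refl _ `[x - d, x + d])) -integrable_mkcond//.
  by apply: continuous_compact_integrable; [exact: segment_compact|exact: continuous_subspaceT].
rewrite integral_mkcond restrictE// -(restrictE _ (@subset_refl _ `[x - d, x + d])).
rewrite -integral_mkcond.
pose F t := t - x.
have dF : derive1 F = cst 1.
  by apply/funext => t; rewrite derive1E deriveB// derive_id derive_cst subr0.
have -> : `[- d, d]%classic = `[F (x - d), F (x + d)]%classic.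
  by rewrite (_ : F (x - d) = - d) 1?(_ : F (x + d) = d)// /F; ring.
rewrite (@integration_by_substitution_increasing _ F); last exact: continuous_subspaceT.
- by apply: eq_integral => t _; rewrite dF /= !fctE mulr1.
- lra.
- by move=> s t _ _; rewrite /F; lra.
- by rewrite dF => t _; exact: cvg_cst.
- by rewrite dF; exact: is_cvg_cst.
- by rewrite dF; exact: is_cvg_cst.
have F_cont t : F s @[s --> t] --> F t by apply: cvgB; [exact: cvg_id|exact: cvg_cst].
split => //.
- by apply: cvg_at_right_filter.
- by apply: cvg_at_left_filter.
Qed.

(** All terms become integrals over the same segment, so they can be added before integrating. *)
Lemma integral_sum_translates (n : nat) (H : 'I_n -> R -> R) (x : 'I_n -> R) (d : R)
    (A : set R) :
    0 < d -> measurable A -> (forall l, continuous (H l)) ->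
    (forall l u, d < `|u| -> H l u = 0) -> (forall u, \sum_l H l u = 0) ->
    (forall l, `[x l - d, x l + d] `<=` A) ->
  mu.-integrable A (fun t => (\sum_l H l (t - x l))%:E) /\
  (\int[mu]_(t in A) (\sum_l H l (t - x l))%:E = 0)%E.
Proof.
move=> d0 mA H_cont H0 sumH sub.
have Hx l := integral_translate d0 mA (H_cont l) (H0 l) (sub l).
have sumE t : ((\sum_l H l (t - x l))%:E = \sum_l (H l (t - x l))%:E)%E.
  by rewrite sumEFin.
under eq_fun do rewrite sumE; split.
  by apply: integrable_sum => // l _; have [] := Hx l.
rewrite integral_sum//; last by move=> l; have [] := Hx l.
under eq_bigr do rewrite (Hx _).2.
rewrite -integral_sum//; last first.
  move=> l; apply: continuous_compact_integrable; first exact: segment_compact.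
  by apply: continuous_subspaceT; exact: H_cont.
by rewrite integral0_eq// => u _; rewrite sumEFin sumH.
Qed.

End Translates.

(** * Construction of the weight on an interval *)

Lemma continuous_det (R : realType) (T : topologicalType) n (A : T -> 'M[R]_n) :
    (forall i j, continuous (fun t => A t i j)) ->
  continuous (fun t => \det (A t)).
Proof.
move=> A_cont; apply: (continuous_big add_continuous) => s _ t.
apply: cvgM; first exact: cvg_cst.
exact: (continuous_big mul_continuous) => i _; exact: A_cont.
Qed.

Section IntervalWeight.
Variables (R : realType) (n : nat) (D : set R) (fs : 'I_n -> R -> R) (g : R -> R).
Variable x : 'I_n.+1 -> R.
Hypothesis D_open : open D.
Hypothesis D_interval : is_interval D.
Hypothesis fs_chebyshev : chebyshev_system D fs.
Hypothesis g_cont : {within D, continuous g}.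
Hypothesis x_homo : {homo x : k l / (k < l)%O >-> k < l}.
Hypothesis xD : forall l, D (x l).
Hypothesis g_alt : forall k : 'I_n, g (x (widen_ord (leqnSn n) k)) * g (x (lift ord0 k)) < 0.

Lemma within_continuous_at (h : R -> R) y :
  {within D, continuous h} -> D y -> {for y, continuous h}.
Proof. by move=> + Dy; rewrite continuous_open_subspace// => /(_ y); apply; rewrite inE. Qed.

(** Finitely many strict inequalities and memberships in an open set persist near [u = 0]. *)
Lemma exists_shift : exists2 d : R, 0 < d & forall u, `|u| <= d ->
  (forall l, D (x l + u)) /\
  (forall k : 'I_n, g (x (widen_ord (leqnSn n) k) + u) * g (x (lift ord0 k) + u) < 0).
Proof.
have shift_cvg l : x l + u @[u --> (0 : R)] --> x l.
  by rewrite -[X in _ --> X]addr0; apply: cvgD; [exact: cvg_cst|exact: cvg_id].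
have gx_cvg l : g (x l + u) @[u --> (0 : R)] --> g (x l).
  by apply: cvg_comp (shift_cvg l) _; exact: within_continuous_at.
have nD : \forall u \near (0 : R), forall l, D (x l + u).
  apply: (@filter_forall _ _ (fun l u => D (x l + u)) (nbhs (0 : R)) _) => l.
  by apply: shift_cvg; exact: open_nbhs_nbhs.
have nalt : \forall u \near (0 : R), forall k : 'I_n,
    g (x (widen_ord (leqnSn n) k) + u) * g (x (lift ord0 k) + u) < 0.
  apply: (@filter_forall _ _ (fun k u => g (x (widen_ord (leqnSn n) k) + u) *
    g (x (lift ord0 k) + u) < 0) (nbhs (0 : R)) _) => k.
  have := cvgM (gx_cvg (widen_ord (leqnSn n) k)) (gx_cvg (lift ord0 k)).
  by move=> gg_cvg; exact: (cvgr_lt _ (gg_cvg _) _ (g_alt k)).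
have [e /= e0 eP] : nbhs_ball (0 : R) (fun u => (forall l, D (x l + u)) /\ forall k : 'I_n,
    g (x (widen_ord (leqnSn n) k) + u) * g (x (lift ord0 k) + u) < 0).
  by rewrite nbhs_ballE; exact: filterI.
(* Half the radius, because the ball is open while [|u| <= d] includes its end points. *)
exists (e / 2) => [|u ud]; first by rewrite divr_gt0.
by apply: eP; rewrite /ball /= sub0r normrN; lra.
Qed.

(** Allowing every measurable [A] around the support lets one statement serve both the open interval
    and the closed segment that parametrizes the circle. *)
Theorem interval_weight : exists (rho : R -> R) (p q : R),
  [/\ D p /\ D q, continuous rho,
      (forall t, 0 <= rho t) /\ (forall t, ~ t \in `[p, q] -> rho t = 0),
      (exists2 t, D t & rho t <> 0) &
      forall A : set R, measurable A -> `[p, q] `<=` A -> forall i,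
        lebesgue_measure.-integrable A (fun t => (g t * fs i t * rho t)%:E) /\
        (\int[lebesgue_measure]_(t in A) (g t * fs i t * rho t)%:E = 0)%E].
Proof.
have [d d0 dP] := exists_shift.
(* Clamping the shift makes the minors below continuous on the whole line. *)
pose clamp u := Num.max (- d) (Num.min u d).
have clampP u : `|clamp u| <= d.
  by rewrite /clamp ler_norml le_max lexx ge_max ge_min lexx orbT andbT; lra.
have clampE u : `|u| <= d -> clamp u = u.
  by rewrite ler_norml /clamp => /andP[? ?]; rewrite min_l// max_r.
have clamp_cont : continuous clamp.
  move=> u; apply: (@continuous_max R R (cst (- d)) (fun v => Num.min v d)).
    exact: cvg_cst.
  by apply: (@continuous_min R R id (cst d)); [exact: cvg_id|exact: cvg_cst].
pose y u l := x l + clamp u.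
have y_homo u : {homo y u : k l / (k < l)%O >-> k < l}.
  by move=> k l /x_homo; rewrite /y ltrD2r.
have yD u l : D (y u l) by exact: (dP _ (clampP u)).1.
have y_alt u k : g (y u (widen_ord (leqnSn n) k)) * g (y u (lift ord0 k)) < 0.
  exact: (dP _ (clampP u)).2.
have comp_cont (h : R -> R) l : {within D, continuous h} -> continuous (fun u => h (y u l)).
  move=> h_cont u; apply: (@continuous_comp R R R (fun v => y v l) h).
    by apply: cvgD; [exact: cvg_cst|exact: clamp_cont].
  exact: within_continuous_at.
pose M u : 'M[R]_(n, n.+1) := \matrix_(i, l) (g (y u l) * fs i (y u l)).
have M_cont i l : continuous (fun u => M u i l).
  under eq_fun do rewrite mxE.
  by move=> u; apply: cvgM; apply: comp_cont => //; case: fs_chebyshev => + _.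
have minor_cont l : continuous (fun u => signed_minor (M u) l).
  move=> u; apply: cvgM; first exact: cvg_cst.
  apply: (@continuous_det R R n (fun v => col' l (M v))) => i j; under eq_fun do rewrite mxE.
  exact: M_cont.
pose psi (u : R) := Num.max 0 (d - `|u|).
have psi_cont : continuous psi.
  move=> u; apply: (@continuous_max R R (cst 0) (fun v => d - `|v|)).
    exact: cvg_cst.
  by apply: cvgB; [exact: cvg_cst|exact: norm_continuous].
have psi_ge0 u : 0 <= psi u by rewrite le_max lexx.
have psi0 u : d <= `|u| -> psi u = 0 by move=> du; rewrite /psi max_l// subr_le0.
(* The common sign of the minors is unknown; the factor [signed_minor (M u) ord0] makes all weights
   nonnegative and is the same for every [l], so the linear relation survives. *)
pose w l u := psi u * (signed_minor (M u) ord0 * signed_minor (M u) l).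
have w_cont l : continuous (w l).
  by move=> u; apply: cvgM; [exact: psi_cont|apply: cvgM; exact: minor_cont].
have minor_gt0 u l : 0 < signed_minor (M u) ord0 * signed_minor (M u) l.
  exact: (signed_minor_same_sign D_interval fs_chebyshev (y_homo u) (yD u) (y_alt u)).
have w_ge0 l u : 0 <= w l u by rewrite mulr_ge0// ltW.
have w0 l u : d <= `|u| -> w l u = 0 by move=> /psi0; rewrite /w => ->; rewrite mul0r.
pose rho t := \sum_l w l (t - x l).
have x_le (k l : 'I_n.+1) : (k <= l)%N -> x k <= x l.
  rewrite leq_eqVlt => /predU1P[/val_inj->//|kl]; exact/ltW/x_homo.
exists rho, (x ord0 - d), (x ord_max + d); split.
- by split; [apply: (dP (- d) _).1; rewrite normrN gtr0_norm|apply: (dP d _).1; rewrite gtr0_norm].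
- apply: (continuous_big add_continuous) => l _ t.
  apply: (@continuous_comp R R R (fun s => s - x l) (w l)); last exact: w_cont.
  by apply: cvgB; [exact: cvg_id|exact: cvg_cst].
- split=> [t|t tpq]; first exact: sumr_ge0.
  rewrite /rho big1// => l _; apply: w0; rewrite leNgt; apply/negP => tl; apply: tpq.
  have := x_le ord0 l (leq0n _); have := x_le l ord_max (leq_ord l).
  by move: tl; rewrite in_itv/= ltr_norml; lra.
(* The bump at [x ord0] is positive at its own centre, as [psi 0 = d], and the others are
   nonnegative. *)
- exists (x ord0) => //; apply/eqP; rewrite gt_eqF// /rho (bigD1 ord0)//= ltr_pwDl//.
    by rewrite mulr_gt0// subrr /psi normr0 subr0 lt_max d0 orbT.
  exact: sumr_ge0.
move=> A mA sub i.
pose H l u := w l u * M u i l.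
have HE t : g t * fs i t * rho t = \sum_l H l (t - x l).
  rewrite mulr_sumr; apply: eq_bigr => l _; rewrite /H mulrC.
  (* Far from [x l] the weight vanishes; near it the clamp is inactive and the shifted point
     [y (t - x l) l] is [t]. *)
  have [tl|tl] := leP d `|t - x l|; first by rewrite w0// !mul0r.
  by rewrite mxE /y clampE ?(ltW tl)// subrKC.
under eq_fun do rewrite HE.
apply: (@integral_sum_translates _ _ H x d) => //.
- by move=> l u; apply: cvgM; [exact: w_cont|exact: M_cont].
- by move=> l u /ltW du; rewrite /H w0// mul0r.
- move=> u; transitivity (psi u * signed_minor (M u) ord0 * \sum_l M u i l * signed_minor (M u) l).
    by rewrite mulr_sumr; apply: eq_bigr => l _; rewrite /H /w; ring.
  by rewrite sum_signed_minor mulr0.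
move=> l t /=; rewrite in_itv/= => tl; apply: sub; rewrite /= in_itv/=.
have := x_le ord0 l (leq0n _); have := x_le l ord_max (leq_ord l).
by move: tl; lra.
Qed.

End IntervalWeight.

(** * From sign changes to alternating points *)

Lemma ereal_lt_between (R : realType) (a b : \bar R) :
  (a < b)%E -> exists x : R, (a < x%:E)%E /\ (x%:E < b)%E.
Proof.
case: a b => [r| |] [s| |] //.
- rewrite lte_fin => rs; exists ((r + s) / 2); rewrite !lte_fin; lra.
- by exists (r + 1); rewrite ltry lte_fin ltrDl.
- by exists (s - 1); rewrite ltNyr lte_fin ltrBlDr ltrDl.
- by exists 0; rewrite ltry ltNyr.
Qed.

Section ErealItv.
Variables (R : realType) (a b : \bar R).
Local Notation D := [set x : R | (a < x%:E)%E /\ (x%:E < b)%E].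

Lemma open_ereal_itv : open D.
Proof. exact: openI (@open_ereal_gt _ a) (@open_ereal_lt _ b). Qed.

Lemma is_interval_ereal_itv : is_interval D.
Proof.
move=> y z [ay yb] [az zb] u /andP[yu uz]; split.
  by apply: lt_le_trans ay _; rewrite lee_fin.
by apply: le_lt_trans zb; rewrite lee_fin.
Qed.

End ErealItv.

Section AlternatingChain.
Variables (R : realType) (a b : \bar R) (g : R -> R).
Local Notation D := [set x : R | (a < x%:E)%E /\ (x%:E < b)%E].

(* The end points that can bound an interval around a zero component: an end e of
   the domain, or a point of the domain where g does not vanish. *)
Definition barrier (e p : \bar R) : Prop :=
  p = e \/ exists r : R, [/\ p = r%:E, D r & g r != 0].

(* Intervals with end points as above contain the whole zero component of t, which
   is all that is used of changes_sign_on. *)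
Definition sign_change_at (t : R) : Prop := forall p q : \bar R,
  barrier a p -> barrier b q -> (p < t%:E)%E -> (t%:E < q)%E ->
  exists x y : R, [/\ (p < x%:E)%E /\ (x%:E < q)%E, (p < y%:E)%E /\ (y%:E < q)%E,
                    g x < 0 & 0 < g y].

(** For zeros of [g] in the domain this says that they lie in different components of the zero
    set. *)
Definition separated (ts : seq R) : Prop :=
  {in ts &, forall s t, s < t -> exists2 z, s < z < t & g z != 0}.

Definition alternation : rel R := fun x y => (x < y) && (g x * g y < 0).

Lemma barrier_le e p : (a < b)%E -> e = a \/ e = b -> barrier e p -> (a <= p)%E /\ (p <= b)%E.
Proof.
by move=> ab eab [->|[r [-> [/ltW ar /ltW rb] _]]] //; case: eab => ->; split=> //; exact: ltW.
Qed.

(** If [t] is last, [q] is [b]; otherwise [q] is a point before the next element where [g] is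
    nonzero, which closes the interval around [t] and opens the next one. *)
Lemma next_barrier t ts :
    path <%R t ts -> separated (t :: ts) -> {in t :: ts, forall s, D s} ->
  exists q, [/\ barrier b q, barrier a q \/ ts = [::], (t%:E < q)%E &
             {in ts, forall s, (q < s%:E)%E}].
Proof.
case: ts => [|s ts] /= t_path sep tD.
  by exists b; split=> //; [left|right|have [] := tD t (mem_head _ _)].
move: t_path => /andP[t_lt_s s_path].
have [||z /andP[tz zs] gz] := sep t s _ _ t_lt_s; rewrite ?inE ?eqxx ?orbT//.
have [at_ _] := tD t (mem_head _ _).
have [_ sb] : D s by apply: tD; rewrite !inE eqxx orbT.
have zP e : barrier e z%:E.
  right; exists z; split=> //; split.
    by apply: lt_trans at_ _; rewrite lte_fin.
  by apply: lt_trans sb; rewrite lte_fin.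
exists z%:E; split; rewrite ?lte_fin//; first by left.
move=> u; rewrite inE => /predU1P[->|uts]; rewrite lte_fin//.
apply: lt_trans zs _; have := s_path; rewrite lt_path_sortedE => /andP[/allP + _].
exact.
Qed.

(** A greedy choice: between [p] and [q] both signs occur, and the one opposite to [g x0] extends
    the chain; [q] then takes the role of [p]. *)
Lemma alternation_path ts p x0 :
    (a < b)%E -> barrier a p \/ ts = [::] -> (x0%:E <= p)%E -> g x0 != 0 ->
    sorted <%R ts -> separated ts ->
    {in ts, forall t, [/\ D t, sign_change_at t & (p < t%:E)%E]} ->
  exists xs, [/\ size xs = size ts, path alternation x0 xs & {in xs, forall x, D x}].
Proof.
move=> ab; elim: ts p x0 => [|t ts IH] p x0 bp x0p gx0 t_path sep tP.
  by exists [::].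
have [tD t_sign pt] := tP t (mem_head _ _).
have {}bp : barrier a p by case: bp.
have [|q [bq aq tq q_lt]] := next_barrier t_path sep; first by move=> s /tP[].
have [x [y [[px xq] [py yq] gx gy]]] := t_sign _ _ bp bq pt tq.
have [ap _] := barrier_le ab (or_introl erefl) bp.
have [_ qb] := barrier_le ab (or_intror erefl) bq.
have [z [pz zq zg]] : exists z, [/\ (p < z%:E)%E, (z%:E < q)%E & g x0 * g z < 0].
  have [gx0_lt|gx0_gt|gx0E] := ltgtP (g x0) 0.
  - by exists y; split=> //; rewrite nmulr_rlt0.
  - by exists x; split=> //; rewrite pmulr_rlt0.
  - by move: gx0; rewrite gx0E eqxx.
have gz : g z != 0 by apply: contraTneq zg => ->; rewrite mulr0 ltxx.
have [||||||xs [xs_size xs_path xsD]] := IH q z.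
- exact: aq.
- exact: ltW.
- exact: gz.
- exact: path_sorted t_path.
- by move=> s u sts uts; apply: sep; rewrite inE ?sts ?uts orbT.
- move=> s sts; have [|sD s_sign _] := tP s; first by rewrite inE sts orbT.
  by split=> //; exact: q_lt.
exists (z :: xs); split=> /=; first by rewrite xs_size.
  by rewrite xs_path /alternation zg -lte_fin (le_lt_trans x0p pz).
move=> u; rewrite inE => /predU1P[->|/xsD//].
by split; [exact: le_lt_trans ap pz|exact: lt_le_trans zq qb].
Qed.

(** The first sign change yields two points, taken in increasing order, and each later one yields
    one more; hence one point more than sign changes. *)
Lemma exists_alternation ts :
    (a < b)%E -> uniq ts -> separated ts ->
    {in ts, forall t, D t /\ sign_change_at t} ->
  exists x0 xs, [/\ size xs = size ts, path alternation x0 xs & {in x0 :: xs, forall x, D x}].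
Proof.
move=> ab ts_uniq sep tP.
have memE : sort <=%R ts =i ts := mem_sort _ ts.
have sizeE : size (sort <=%R ts) = size ts := size_sort _ ts.
have {ts_uniq} : sorted <%R (sort <=%R ts).
  by rewrite lt_sorted_uniq_le sort_uniq ts_uniq sort_le_sorted.
have {}sep : separated (sort <=%R ts) by move=> s t; rewrite !memE; exact: sep.
have {memE}tP : {in sort <=%R ts, forall t, D t /\ sign_change_at t}.
  by move=> t; rewrite memE; exact: tP.
rewrite -sizeE; case: (sort _ _) sep tP => {ts sizeE} [|t ts] sep tP t_path.
  have [x xD] : exists x, D x by exact: ereal_lt_between.
  by exists x, [::]; split=> // y; rewrite inE => /eqP->.
have [tD t_sign] := tP t (mem_head _ _).
have [|q [bq aq tq q_lt]] := next_barrier t_path sep; first by move=> s /tP[].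
have [x [y [[ax xq] [ay yq] gx gy]]] := t_sign a q (or_introl erefl) bq tD.1 tq.
have [_ qb] := barrier_le ab (or_intror erefl) bq.
have [u [v [uD vD uv vq]]] : exists u v, [/\ D u, D v, alternation u v & (v%:E <= q)%E].
  have xD : D x by split=> //; exact: lt_le_trans xq qb.
  have yD : D y by split=> //; exact: lt_le_trans yq qb.
  have [xy|yx|xyE] := ltgtP x y.
  - exists x, y; split=> //; last exact: ltW.
    by rewrite /alternation xy pmulr_llt0.
  - exists y, x; split=> //; last exact: ltW.
    by rewrite /alternation yx pmulr_rlt0.
  - by move: gx; rewrite xyE => /(lt_trans gy); rewrite ltxx.
have gv : g v != 0.
  by apply: contraTneq uv => gv; rewrite /alternation gv mulr0 ltxx andbF.
have [||||||xs [xs_size xs_path xsD]] := @alternation_path ts q v ab.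
- exact: aq.
- exact: vq.
- exact: gv.
- exact: path_sorted t_path.
- by move=> s s' sts uts; apply: sep; rewrite inE ?sts ?uts orbT.
- move=> s sts; have [|sD s_sign] := tP s; first by rewrite inE sts orbT.
  by split=> //; exact: q_lt.
exists u, (v :: xs); split=> /=; [by rewrite xs_size|by rewrite uv|].
by move=> s; rewrite !inE => /or3P[/eqP->|/eqP->|/xsD].
Qed.

End AlternatingChain.

(** Phrased with points and [sign_change_at] instead of zero components, so that the circle, cut
    open at one point, can use it too. *)
Theorem exists_weight_ereal_itv (R : realType) (a b : \bar R) (n : nat)
    (fs : 'I_n -> R -> R) (g : R -> R) (t : 'I_n -> R) :
    let D := [set x : R | (a < x%:E)%E /\ (x%:E < b)%E] in
    (a < b)%E -> chebyshev_system D fs -> {within D, continuous g} ->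
    (forall i, D (t i) /\ sign_change_at a b g (t i)) ->
    injective t -> (forall i j, t i < t j -> exists2 z, t i < z < t j & g z != 0) ->
  exists (rho : R -> R) (p q : R),
  [/\ D p /\ D q, continuous rho,
      (forall t, 0 <= rho t) /\ (forall t, ~ t \in `[p, q] -> rho t = 0),
      (exists2 t, D t & rho t <> 0) &
      forall A : set R, measurable A -> `[p, q] `<=` A -> forall i,
        lebesgue_measure.-integrable A (fun t => (g t * fs i t * rho t)%:E) /\
        (\int[lebesgue_measure]_(t in A) (g t * fs i t * rho t)%:E = 0)%E].
Proof.
move=> D ab fs_chebyshev g_cont tP t_inj t_sep.
have [|||x0 [xs [xs_size xs_path xsD]]] := @exists_alternation R a b g (codom t) ab.
- exact/injectiveP.
- by move=> _ _ /codomP[i ->] /codomP[j ->]; exact: t_sep.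
- by move=> _ /codomP[i ->].
rewrite size_codom card_ord in xs_size.
pose x (l : 'I_n.+1) := nth 0 (x0 :: xs) l.
have D_open : open D := @open_ereal_itv R a b.
have D_interval : is_interval D := @is_interval_ereal_itv R a b.
apply: (@interval_weight R n D fs g x) => //.
- have : sorted <%R (x0 :: xs) by apply: sub_path xs_path => y z /andP[].
  move=> xs_sorted k l kl; rewrite /x lt_sorted_ltn_nth//= inE /= xs_size; exact: ltn_ord.
- by move=> l; apply: xsD; apply: mem_nth; rewrite /= xs_size.
move=> k; have /(pathP 0) /(_ k) := xs_path; rewrite xs_size ltn_ord => /(_ isT) /andP[_].
exact.
Qed.

(** * Zero components and the case of an interval *)

Lemma sign_changes_representatives (R : realType) (T : topologicalType) (D : set T)
    (f : T -> R) n :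
    `I_n #<= sign_changes D f ->
  exists t : 'I_n -> T,
    injective (fun i => connected_component (zero_set D f) (t i)) /\
    forall i, zero_set D f (t i) /\
              changes_sign_on D f (connected_component (zero_set D f) (t i)).
Proof.
move=> /pcard_leP[C].
have CP (i : 'I_n) : sign_changes D f (C i) by apply: (@funS _ _ _ _ C); exact: ltn_ord.
have /choice [t tP] (i : 'I_n) : exists t, zero_set D f t /\
    connected_component (zero_set D f) t = C i.
  by have [[t tZ tC] _] := CP i; exists t.
exists t; split=> [i j|i].
  rewrite (tP i).2 (tP j).2 => CE; apply: val_inj.
  by apply: (@inj _ _ _ C) => //; rewrite inE /=; exact: ltn_ord.
by split; [exact: (tP i).1|rewrite (tP i).2; exact: (CP i).2].
Qed.

Lemma exists_weight_interval (R : realType) (a b : \bar R) (ab : (a < b)%E) n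
    (fs : 'I_n -> R -> R) (f : R -> R) :
    let D := OpenInterval ab in
    chebyshev_system (points D) fs -> {within points D, continuous f} ->
    `I_n #<= sign_changes (points D) f ->
  exists rho : R -> R,
    [/\ {within points D, continuous rho}, constant_sign (points D) rho &
        forall i : 'I_n, @orthogonal_with_weight R D rho f (fs i)].
Proof.
move=> /= fs_chebyshev f_cont /sign_changes_representatives [t [t_inj tP]].
set D := [set x : R | _] in fs_chebyshev f_cont t_inj tP *.
pose Z := zero_set D f.
have D_interval : is_interval D := @is_interval_ereal_itv R a b.
(* If [f] vanished on the whole segment, this connected set would join two different zero
   components. *)
have t_sep i j : t i < t j -> exists2 z, t i < z < t j & f z != 0.
  move=> tij; apply: contrapT => no_z.
  suff : connected_component Z (t i) (t j).
    by move=> /same_connected_component/t_inj ijE; move: tij; rewrite ijE ltxx.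
  apply: (@connected_component_max _ Z `[t i, t j]); rewrite /= ?in_itv/= ?lexx ?(ltW tij)//.
    move=> z /=; rewrite in_itv/= => /andP[iz zj]; split.
      by apply: (D_interval _ _ (tP i).1.1 (tP j).1.1); rewrite iz.
    have [->|zi] := eqVneq z (t i); first exact: (tP i).1.2.
    have [->|zj'] := eqVneq z (t j); first exact: (tP j).1.2.
    apply: contrapT => /eqP fz; apply: no_z; exists z => //.
    by rewrite !lt_neqAle eq_sym zi iz zj' zj.
  exact: segment_connected.
have t_sign i : sign_change_at a b f (t i).
  move=> p q bp bq pt tq; pose U := [set x : R | (p < x%:E)%E /\ (x%:E < q)%E].
  have Ci : is_interval (connected_component Z (t i)).
    by apply/connected_intervalP; exact: component_connected.
  have ti : connected_component Z (t i) (t i) by apply: connected_component_refl; exact: (tP i).1.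
  (* The component is an interval without points where [f] is nonzero, so no barrier can cut it, and
     [U] is a neighbourhood of it. *)
  have sub : connected_component Z (t i) `<=` U.
    move=> c ci; have [[ac cb] fc] := connected_component_sub ci; split.
      case: bp pt => [->//|[r [-> rD fr]]]; rewrite !lte_fin => rt; rewrite ltNge; apply/negP => cr.
      have [_ /eqP] : Z r; last by rewrite (negPf fr).
      by apply: (@connected_component_sub _ _ (t i)); apply: Ci ci ti _ _; rewrite cr ltW.
    case: bq tq => [->//|[r [-> rD fr]]]; rewrite !lte_fin => rt; rewrite ltNge; apply/negP => cr.
    have [_ /eqP] : Z r; last by rewrite (negPf fr).
    by apply: (@connected_component_sub _ _ (t i)); apply: Ci ti ci _ _; rewrite cr ltW.
  have [|x [y [[_ [px xq]] [_ [py yq]] fx fy]]] := (tP i).2 U.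
    by apply/set_nbhsP; exists U; split=> //; exact: open_ereal_itv.
  by exists x, y.
have t_inj' : injective t by move=> i j tij; apply: t_inj; rewrite tij.
have [rho [p [q [[pD qD] rho_cont [rho_ge0 rho0] rho_neq0 rhoP]]]] :=
  exists_weight_ereal_itv ab fs_chebyshev f_cont (fun i => conj (tP i).1.1 (t_sign i)) t_inj' t_sep.
exists rho; split; first exact: continuous_subspaceT.
  by split=> //; left.
move=> i; apply: rhoP.
  by apply: measurable_realfun.open_measurable; exact: open_ereal_itv.
by move=> x /=; rewrite in_itv/=; exact: D_interval.
Qed.

(** * The circle *)

Section CircleParam.
Variable R : realType.
Local Notation proj := (@circle_pi R).
Local Notation period := (2 * pi : R).

Lemma period_gt0 : 0 < period.
Proof. by rewrite mulr_gt0// pi_gt0. Qed.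

Lemma circle_piP (x y : R) : proj x = proj y <-> exists k : int, x = y + k%:~R * period.
Proof.
split.
  move=> /eqmodP/asboolP[k xy]; exists k; rewrite -xy; ring.
by move=> [k ->]; apply/eqmodP/asboolP; exists k; ring.
Qed.

Lemma circle_pi_lift (p : R) (z : circle R) : exists2 r, p <= r < p + period & proj r = z.
Proof.
have [s <-] : exists s, proj s = z.
  by exists (repr z); exact: reprK.
pose k := Num.floor ((s - p) / period).
exists (s - k%:~R * period).
  have := ge_floor ((s - p) / period); have := lt_succ_floor ((s - p) / period).
  rewrite -/k intrD ltr_pdivrMr ?period_gt0// ler_pdivlMr ?period_gt0//.
  by rewrite mulrDl mul1r; lra.
by apply/circle_piP; exists (- k); rewrite mulrNz mulNr.
Qed.

Lemma circle_pi_inj (p x y : R) : p <= x < p + period -> p <= y < p + period ->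
  proj x = proj y -> x = y.
Proof.
move=> xp yp /circle_piP[k xE]; have T0 := period_gt0.
have k_lt1 : k < 1.
  by rewrite -(ltr_int R) -(ltr_pM2r T0) mul1r; lra.
have k_gtN1 : -1 < k.
  by rewrite -(ltr_int R) -(ltr_pM2r T0) mulrNz mulN1r; lra.
have k0 : k = 0 by lia.
by rewrite xE k0 mul0r addr0.
Qed.

Lemma circle_pi_continuous : continuous proj.
Proof. exact: pi_continuous. Qed.

Lemma circle_pi_open (p q : R) : open (proj @` `]p, q[).
Proof.
(* Open sets of the quotient are those with open preimage; here it is the union of all translates of
   the interval. *)
suff : open (proj @^-1` (proj @` `]p, q[)) by [].
rewrite (_ : _ @^-1` _ =
    \bigcup_(k in [set: int]) `]p + k%:~R * period, q + k%:~R * period[%classic).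
  by apply: bigcup_open => k _; exact: itv_open.
apply/seteqP; split=> [x [y yp /circle_piP[k yE]]|x [k _ xp]].
  exists (- k) => //=; move: yp; rewrite /= !in_itv/= yE mulrNz mulNr; lra.
exists (x - k%:~R * period); last first.
  by apply/circle_piP; exists (- k); rewrite mulrNz mulNr.
by move: xp; rewrite /= !in_itv/=; lra.
Qed.

(** Removing [proj p] and [proj q] leaves two disjoint open arcs, the second one empty if
    [q = p + period]; a connected set that meets the first stays in it. *)
Lemma circle_arc_connected (C : set (circle R)) (p t q : R) :
    connected C -> p < t < q -> q <= p + period -> C (proj t) ->
    ~ C (proj p) -> ~ C (proj q) ->
  C `<=` proj @` `]p, q[.
Proof.
move=> C_conn /andP[pt tq] qp Ct Cp Cq.
pose U := proj @` `]p, q[; pose V := proj @` `]q, p + period[.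
have UV : C `<=` U `|` V.
  move=> z Cz; have [r /andP[pr rp] rz] := circle_pi_lift p z.
  have pr' : p != r by apply/eqP => prE; apply: Cp; rewrite prE rz.
  have qr' : q != r by apply/eqP => qrE; apply: Cq; rewrite qrE rz.
  have [rq|qr|qrE] := ltgtP r q; last by move: qr'; rewrite qrE eqxx.
    by left; exists r => //=; rewrite in_itv/= lt_neqAle pr' pr.
  by right; exists r => //=; rewrite in_itv/= qr.
have UV0 z : U z -> ~ V z.
  move=> [r rU <-] [s sV srE]; move: rU sV; rewrite /= !in_itv/= => rU sV.
  by have : s = r; [apply: (circle_pi_inj (p := p)) srE; lra|lra].
have <- : C `&` U = C.
  apply: C_conn.
  - by exists (proj t); split=> //; exists t => //=; rewrite in_itv/= pt.
  - by exists U => //; exact: circle_pi_open.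
  - exists (~` V); first by apply: open_closedC; exact: circle_pi_open.
    by apply/seteqP; split=> z [Cz Uz]; split=> //; [exact: UV0|have [] := UV z Cz].
by move=> z [].
Qed.

(** [rho] vanishes near both ends of the period, so gluing them keeps continuity. The last
    conclusion transfers the sign of [rho]. *)
Lemma periodic_extension (rho : R -> R) (p q : R) :
    0 < p -> q < period -> continuous rho -> (forall t, ~ t \in `[p, q] -> rho t = 0) ->
  exists2 rhoC : circle R -> R, continuous rhoC &
    (forall t, 0 <= t <= period -> rhoC (proj t) = rho t) /\
    (forall z, exists t, rhoC z = rho t).
Proof.
move=> p0 qT rho_cont rho0; have T0 := period_gt0.
pose e := Num.min p (period - q).
have e0 : 0 < e by rewrite lt_min p0 subr_gt0.
have ep : e <= p by rewrite ge_min lexx.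
have eq : e <= period - q by rewrite ge_min lexx orbT.
(* Congruent points of the period and of its enlargement by the margin [e] either coincide or both
   avoid the support. *)
have rhoE (r s : R) (k : int) : r = s + k%:~R * period -> 0 <= r < period ->
    - e < s < period + e -> rho r = rho s.
  move=> rE r_lt s_lt.
  have [k_lt0|k_gt0|k0] := ltgtP k 0; last by rewrite rE k0 mul0r addr0.
    have kT : k%:~R * period <= - period.
      by rewrite -mulN1r ler_pM2r// -mulrN1z ler_int; lia.
    by rewrite !rho0// in_itv/=; lra.
  have kT : period <= k%:~R * period.
    by rewrite -[leLHS]mul1r ler_pM2r// -[leLHS]mulr1z ler_int; lia.
  by rewrite !rho0// in_itv/=; lra.
have /choice [r rP] t : exists r : R, 0 <= r < period /\ exists k : int, r = t + k%:~R * period.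
  have [r] := circle_pi_lift 0 (proj t); rewrite add0r => rT /circle_piP rE.
  by exists r.
have r_proj s t : proj s = proj t -> r s = r t.
  move=> st; have [rs rsE] := rP s; have [rt rtE] := rP t.
  apply: (circle_pi_inj (p := 0)); rewrite ?add0r//.
  transitivity (proj s); first exact/circle_piP.
  by rewrite st; apply/esym/circle_piP.
pose P t := rho (r t).
have P_cont : continuous P.
  move=> t; have [rt [k rtE]] := rP t.
  pose Q s := rho (s + k%:~R * period).
  (* Near [t] the translation by the fixed [k] replaces the discontinuous choice [r]. *)
  have QP : \forall s \near t, Q s = P s.
    apply/nbhs_ballP; exists e => // s st; have [rs [l rsE]] := rP s.
    apply/esym/(rhoE _ _ (l - k)) => //; first by rewrite rsE intrB; ring.
    by move: st; rewrite /ball/= ltr_norml; lra.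
  rewrite /continuous_at {2}/P rtE -/(Q t); apply: cvg_trans (near_eq_cvg QP) _.
  apply: (@continuous_comp _ _ _ (fun s => s + k%:~R * period) rho); last exact: rho_cont.
  by apply: cvgD; [exact: cvg_id|exact: cvg_cst].
exists (P \o repr).
  apply: repr_comp_continuous => // s t /eqP st; apply/eqP.
  by rewrite /P (r_proj s t).
split=> [t t_le|z]; last by exists (r (repr z)).
have [rt [k rtE]] := rP t.
rewrite /= /P (r_proj (repr (proj t)) t); last exact: reprK.
by apply: rhoE rtE rt _; lra.
Qed.

End CircleParam.

(** * Reduction of the circle to the interval from 0 to 2 pi *)

Lemma exists_weight_circle (R : realType) n (fs : 'I_n -> circle R -> R) (f : circle R -> R) :
    let D := @Circle R in
    chebyshev_system (points D) fs -> {within points D, continuous f} ->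
    `I_n.+1 #<= sign_changes (points D) f ->
  exists rho : circle R -> R,
    [/\ {within points D, continuous rho}, constant_sign (points D) rho &
        forall i : 'I_n, @orthogonal_with_weight R D rho f (fs i)].
Proof.
move=> /= fs_chebyshev f_cont /sign_changes_representatives [t [t_inj tP]].
pose Z := zero_set [set: circle R] f; pose C i := connected_component Z (t i).
have Ct i : C i (t i) by apply: connected_component_refl; exact: (tP i).1.
have T0 := @period_gt0 R.
have circle_cont (h : circle R -> R) :
    {within [set: circle R], continuous h} -> continuous (h \o @circle_pi R).
  move=> h_cont x; apply: continuous_comp; first exact: circle_pi_continuous.
  exact: (continuous_subspace_setT h).2 h_cont _.
(* [i0] is the index of the component through the cut point, or arbitrary if there is none;
   [lift i0] enumerates the [n] others. *)
have [i0 i0P] : exists i0, forall i, i != i0 -> ~ C i (circle_pi 0).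
  have [[i0 i0C]|no_i] := pselect (exists i, C i (circle_pi 0)).
    exists i0 => i /eqP ii0 iC; apply: ii0; apply: t_inj.
    by rewrite (same_connected_component iC) (same_connected_component i0C).
  by exists ord0 => i _ iC; apply: no_i; exists i.
have CP (j : 'I_n) : ~ C (lift i0 j) (circle_pi 0) by apply: i0P; rewrite eq_sym neq_lift.
have /choice [s sP] (j : 'I_n) : exists s, 0 < s < 2 * pi /\ circle_pi s = t (lift i0 j).
  have [r] := circle_pi_lift 0 (t (lift i0 j)); rewrite add0r => /andP[r0 rT] rE.
  exists r; split=> //; rewrite rT andbT lt_neqAle r0 andbT; apply/eqP => r0E.
  by apply: (CP j); rewrite r0E rE.
have sC j : C (lift i0 j) (circle_pi (s j)) by rewrite (sP j).2.
have T_lt : (0%:E < (2 * pi)%:E :> \bar R)%E by rewrite lte_fin.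
pose g := f \o @circle_pi R.
pose D := [set x : R | (0%:E < x%:E)%E /\ (x%:E < (2 * pi)%:E)%E].
have DE x : D x -> 0 < x < 2 * pi by rewrite /D /= !lte_fin => -[-> ->].
have ED x : 0 < x < 2 * pi -> D x by rewrite /D /= !lte_fin => /andP.
(* The projection is injective on the open period, so zeros on the line inject into zeros on the
   circle. *)
have gs_chebyshev : chebyshev_system D (fun j => fs j \o @circle_pi R).
  have [fs_cont fs_zeros] := fs_chebyshev.
  split=> [j|c /fs_zeros]; first exact/continuous_subspaceT/circle_cont.
  apply: card_le_trans.
  have pi_inj : {in zero_set D (fun x => \sum_(j < n) c j * (fs j \o @circle_pi R) x) &,
      injective (@circle_pi R)}.
    move=> x y /[!inE] -[/DE xD _] [/DE yD _]; apply: (circle_pi_inj (p := 0)).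
      by rewrite add0r; lra.
    by rewrite add0r; lra.
  rewrite -(card_le_eql (inj_card_eq pi_inj)); apply: subset_card_le.
  by move=> _ [x [_ xZ] <-].
have s_sign j : sign_change_at 0%:E (2 * pi)%:E g (s j).
  move=> p q bp bq.
  (* A barrier is an end of the period, which projects to the cut point, or a point where [g] is
     nonzero; neither lies in the component, which is thus confined to an arc. *)
  have notC e u : 0 <= e <= 2 * pi -> circle_pi e = circle_pi 0 ->
      barrier 0%:E (2 * pi)%:E g e%:E u ->
      exists2 r, u = r%:E & 0 <= r <= 2 * pi /\ ~ C (lift i0 j) (circle_pi r).
    move=> e_le e0 [->|[r [-> /DE /andP[r0 rT] gr]]].
      by exists e => //; split=> //; rewrite e0; exact: CP.
    exists r => //; split; first by rewrite !ltW.
    by move=> /connected_component_sub[_ /eqP]; apply/negP.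
  have [|p' -> [p'_le p'C]] := notC _ _ _ erefl bp.
    by rewrite lexx ltW.
  have [||q' -> [q'_le q'C]] := notC _ _ _ _ bq.
    by rewrite lexx ltW.
    by apply/circle_piP; exists 1; rewrite add0r mul1r.
  rewrite !lte_fin => ps sq.
  have sub : C (lift i0 j) `<=` @circle_pi R @` `]p', q'[.
    apply: (circle_arc_connected (t := s j)) => //; [exact: component_connected|exact/andP|lra].
  have [|x [y [[_ [x' xpq <-]] [_ [y' ypq <-]] fx fy]]] :=
      (tP (lift i0 j)).2 (@circle_pi R @` `]p', q'[).
    by apply/set_nbhsP; exists (@circle_pi R @` `]p', q'[); split=> //; exact: circle_pi_open.
  exists x', y'; move: xpq ypq; rewrite /= !in_itv/= !lte_fin.
  by move=> /andP[? ?] /andP[? ?].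
have s_inj : injective s.
  by move=> i j sij; apply: (@lift_inj _ i0); apply: t_inj; rewrite -(sP i).2 sij (sP j).2.
have s_sep i j : s i < s j -> exists2 z, s i < z < s j & g z != 0.
  move=> sij; apply: contrapT => no_z.
  suff : C (lift i0 i) (t (lift i0 j)).
    by move=> /same_connected_component/t_inj/lift_inj ijE; move: sij; rewrite ijE ltxx.
  have sZ k : Z (circle_pi (s k)) by rewrite (sP k).2; exact: (tP _).1.
  apply: (@connected_component_max _ Z (@circle_pi R @` `[s i, s j])).
  - by exists (s i); [rewrite /= in_itv/= lexx ltW|exact: (sP i).2].
  - move=> _ [z + <-]; rewrite /= in_itv/= => /andP[iz zj]; split=> //.
    have [->|zi] := eqVneq z (s i); first exact: (sZ i).2.
    have [->|zj'] := eqVneq z (s j); first exact: (sZ j).2.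
    apply: contrapT => /eqP fz; apply: no_z; exists z => //.
    by rewrite !lt_neqAle eq_sym zi iz zj' zj.
  - apply: connected_continuous_connected; first exact: segment_connected.
    by apply: continuous_subspaceT; exact: circle_pi_continuous.
  by exists (s j); [rewrite /= in_itv/= lexx ltW|exact: (sP j).2].
have [rho [p [q [[/DE pD /DE qD] rho_cont [rho_ge0 rho0] [x /DE xD rho_neq0] rhoP]]]] :=
  exists_weight_ereal_itv T_lt gs_chebyshev (continuous_subspaceT (circle_cont _ f_cont))
    (fun i => conj (ED _ (sP i).1) (s_sign i)) s_inj s_sep.
have [||rhoC rhoC_cont [rhoCE rhoC_val]] := periodic_extension (p := p) (q := q) _ _ rho_cont rho0.
- by case/andP: pD.
- by case/andP: qD.
exists rhoC; split; first exact: continuous_subspaceT.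
  split; first by left=> z _; have [u ->] := rhoC_val z.
  by exists (circle_pi x) => //; rewrite rhoCE//; lra.
(* The circle is integrated over the closed segment, which contains the support of [rho]. *)
move=> i; have [||h_int h0] := rhoP `[0, 2 * pi]%classic _ _ i.
- by apply: measurable_itv.
- by move=> u /=; rewrite !in_itv/=; lra.
have hE : {in `[0, 2 * pi]%classic, (fun u => (g u * (fs i \o @circle_pi R) u * rho u)%:E) =1
    (fun u => (f (circle_pi u) * fs i (circle_pi u) * rhoC (circle_pi u))%:E)}.
  by move=> u; rewrite inE/= in_itv/= => uT; rewrite rhoCE.
split=> /=; first by move: h_int; apply: eq_integrable; [exact: measurable_itv|exact: hE].
by rewrite -[RHS]h0; apply: eq_integral => u uT; rewrite hE.
Qed.

Theorem theorem2 (R : realType) (D : domain R) (n : nat)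
    (fs : 'I_n -> ambient D -> R) (f : ambient D -> R)
    (fs_chebyshev : chebyshev_system (points D) fs)
    (f_continuous : {within points D, continuous f})
    (f_sign_changes :
      `I_(required_sign_changes D n) #<= sign_changes (points D) f) :
  exists rho : ambient D -> R,
    [/\ {within points D, continuous rho},
        constant_sign (points D) rho &
        forall i : 'I_n, orthogonal_with_weight rho f (fs i)].
Proof.
case: D fs f fs_chebyshev f_continuous f_sign_changes => [a b ab|] fs f.
  exact: exists_weight_interval.
exact: exists_weight_circle.
Qed.
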